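(* Let $n \geq 1$, let $p \in (-\infty, 1) \setminus \{0\}$, and let $\mathbf{A}, \mathbf{B}$ be $n \times n$ complex matrices that are Hermitian and positive semi-definite (positive definite if $p < 0$). Then $$\| \mathbf{A} + \mathbf{B} \|_p \geq \| \mathbf{A} \|_p + \| \mathbf{B} \|_p, \qquad (1)$$ and, provided that $\mathbf{A} - \mathbf{B}$ is positive semi-definite (positive definite if $p < 0$), $$\| \mathbf{A} - \mathbf{B} \|_p \leq \| \mathbf{A} \|_p - \| \mathbf{B} \|_p. \qquad (2)$$ In both (1) and (2), equality is achieved if and only if $\mathbf{A} = c \mathbf{B}$ for some $c \in \mathbb{R}_{\geq 0}$ ($c \in \mathbb{R}_{>0}$ if $p < 0$).
   Context: For a Hermitian positive semi-definite (positive definite if $p<0$) $n \times n$ complex matrix $\mathbf{A}$ and real $p \neq 0$, the normalized Schatten-type operator is $\| \mathbf{A} \|_p := \left( \frac{1}{n} \operatorname{trace}(\mathbf{A}^p) \right)^{1/p}$. Equivalently, $\|\mathbf{A}\|_p = \left( \frac{1}{n} \sum_{i=1}^n \lambda_i(\mathbf{A})^p \right)^{1/p}$, where $\lambda_1(\mathbf{A}), \dots, \lambda_n(\mathbf{A})$ are the eigenvalues of $\mathbf{A}$ counted with multiplicity.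
   Formalization: In the equality cases of (1) and (2) the alternative ''or B = 0'' is added, since for 0 < p < 1, B = 0 and A ≠ 0 equality holds although A is not a multiple of B; for B ≠ 0 the condition is as printed. *)

(* Defs.v *)
From HB Require Import structures.
From mathcomp Require Import all_boot all_order all_algebra spectral.
From mathcomp Require Import complex.
From mathcomp Require Import reals exp.

Set Implicit Arguments.
Unset Strict Implicit.
Unset Printing Implicit Defensive.

Import Order.TTheory GRing.Theory Num.Theory.

Local Open Scope ring_scope.
Local Open Scope complex_scope.
Local Open Scope sesquilinear_scope.

(* In the two definitions below the order is that of R[i], for which 0 <= z
   (resp. 0 < z) means that z is real and nonnegative (resp. positive). *)
Definition psdmx (R : realType) (n : nat) (A : 'M[R[i]]_n) : Prop :=
  A \is hermsymmx /\
  forall x : 'cV[R[i]]_n, 0 <= (x ^t* *m A *m x) 0 0.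

Definition pdmx (R : realType) (n : nat) (A : 'M[R[i]]_n) : Prop :=
  A \is hermsymmx /\
  forall x : 'cV[R[i]]_n, x != 0 -> 0 < (x ^t* *m A *m x) 0 0.

Definition admissible (R : realType) (n : nat) (p : R) (A : 'M[R[i]]_n) : Prop :=
  if p < 0 then pdmx A else psdmx A.

(* A^p by functional calculus on the unitary diagonalization
   A = invmx (spectralmx A) *m diag_mx (spectral_diag A) *m spectralmx A,
   which holds for every normal A (orthomx_spectralP); the eigenvalues are real
   when A is Hermitian. Since powR 0 p = 0 for p != 0, this is the usual power
   for A positive semi-definite and p > 0, and for A positive definite. *)
Definition powmx (R : realType) (n : nat) (A : 'M[R[i]]_n) (p : R) : 'M[R[i]]_n :=
  invmx (spectralmx A) *m
  diag_mx (\row_j (powR (complex.Re (spectral_diag A 0 j)) p)%:C) *m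
  spectralmx A.

Definition schatten (R : realType) (n : nat) (p : R) (A : 'M[R[i]]_n) : R :=
  powR (n%:R^-1 * complex.Re (\tr (powmx A p))) p^-1.

Lemma schattenE (R : realType) (n : nat) (p : R) (A : 'M[R[i]]_n) :
  schatten p A =
  powR (n%:R^-1 * \sum_j powR (complex.Re (spectral_diag A 0 j)) p) p^-1.
Proof.
rewrite /schatten /powmx mxtrace_mulC mulmxA mulmxV ?spectral_unit// mul1mx.
rewrite mxtrace_diag raddf_sum /=.
by congr (powR (_ * _) _); apply: eq_bigr => j _; rewrite mxE.
Qed.

(* For 0 < p < 1, B = 0 and A != 0, equality holds trivially although A is not a
   multiple of B; hence the extra alternative B = 0 in the equality cases of
   the theorem. *)
Definition nonneg_multiple (R : realType) (n : nat) (p : R)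
    (A B : 'M[R[i]]_n) : Prop :=
  exists c : R, (if p < 0 then 0 < c else 0 <= c) /\ A = c%:C *: B.

(* Main.v *)
(** The function [t^p / p] is strictly concave on the domain of eigenvalues, both for
    [0 < p < 1] and for [p < 0].  Let [C = s A + t B] with [s + t = 1].  In an eigenbasis of
    [C], the diagonal entries of [A] are averages of the eigenvalues of [A] with doubly
    stochastic weights [|W i j|^2], [W] unitary, and likewise for [B].  Jensen's inequality
    thus gives [s tr A^p / p + t tr B^p / p <= tr C^p / p], and in the equality case the
    eigenbasis of [C] diagonalizes [A] and [B] with equal eigenvalues, i.e. [A = B].
    Superadditivity is this statement for the normalized matrices [A / ||A||] and
    [B / ||B||], with weights proportional to [||A||] and [||B||]; the second inequality is
    the first one for [A - B] and [B]. *)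

Require Import Defs.
From HB Require Import structures.
From mathcomp Require Import all_boot all_order all_algebra spectral.
From mathcomp Require Import complex ring lra.
From mathcomp Require Import reals exp.

Set Implicit Arguments.
Unset Strict Implicit.
Unset Printing Implicit Defensive.

Import Order.TTheory GRing.Theory Num.Theory.

Local Open Scope ring_scope.
Local Open Scope complex_scope.
Local Open Scope sesquilinear_scope.

(* The eigenvalues allowed by [admissible p]; it also expresses the condition on
   the factor [c] in [nonneg_multiple p]. *)
Definition power_domain (R : realType) (p x : R) : bool :=
  if p < 0 then 0 < x else 0 <= x.

(* Dividing by [p] makes the power increasing and concave for either sign of [p]. *)
Definition npow (R : realType) (p x : R) : R := p^-1 * powR x p.

(** * Strict concavity and monotonicity of the scalar power, and Jensen's inequality *)

Section ScalarPower.
Variables (R : realType) (p : R).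
Hypotheses (p_lt1 : p < 1) (p_neq0 : p != 0).

Lemma power_domain_ge0 (x : R) : power_domain p x -> 0 <= x.
Proof. by rewrite /power_domain; case: ifP => // _ /ltW. Qed.

Lemma gt0_power_domain (x : R) : 0 < x -> power_domain p x.
Proof. by rewrite /power_domain; case: ifP => // _ /ltW. Qed.

Lemma power_domainM (k x : R) : 0 < k -> power_domain p x -> power_domain p (k * x).
Proof. by move=> k0; rewrite /power_domain pmulr_rgt0// pmulr_rge0. Qed.

(** For [p < 0] positivity must be strict: a vanishing mean of positive points would force all
    weights to vanish, against their sum being [1]. *)
Lemma power_domain_sum (I : finType) (w x : I -> R) :
  (forall i, 0 <= w i) -> \sum_i w i = 1 -> (forall i, power_domain p (x i)) ->
  power_domain p (\sum_i w i * x i).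
Proof.
move=> w0 w1; rewrite /power_domain; case: ifP => _ x0; last first.
  by apply: sumr_ge0 => i _; rewrite mulr_ge0.
rewrite lt_neqAle eq_sym sumr_ge0 ?andbT => [|i _]; last by rewrite mulr_ge0// ltW.
apply/negP; rewrite psumr_eq0 => [/allP h|i _]; last by rewrite mulr_ge0// ltW.
have := oner_neq0 R; rewrite -w1 big1 ?eqxx// => i _.
by have /eqP := h i (mem_index_enum i) => /eqP; rewrite mulf_eq0 (gt_eqF (x0 i)) orbF => /eqP.
Qed.

Lemma npow1 : npow p 1 = p^-1.
Proof. by rewrite /npow powR1 mulr1. Qed.

Lemma npowM (k x : R) : 0 <= k -> 0 <= x -> npow p (k * x) = powR k p * npow p x.
Proof. by move=> k0 x0; rewrite /npow powRM// mulrCA. Qed.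

(** Everything comes from the strict bound [1 + u < expR u] for [u != 0]. When [p < 0], it is used
    at [p * ln x] and at [ln x], with [ln x] as the intermediate bound. *)
Lemma npow_lt_tangent1 (x : R) :
  power_domain p x -> x != 1 -> npow p x - npow p 1 < x - 1.
Proof.
move=> + x1; rewrite npow1 -[X in _ - X < _]mulr1 /npow -mulrBr.
rewrite /power_domain; have [p0 x0|p0] := ltP p 0.
  have lx : ln x != 0 by rewrite ln_eq0.
  have h1 : 1 + p * ln x < powR x p.
    by rewrite /powR gt_eqF// expR_gt1Dx// mulf_neq0.
  have h2 : 1 + ln x < x by rewrite -[ltRHS]lnK ?posrE// expR_gt1Dx.
  by rewrite ltr_ndivrMl//; nra.
have p_gt0 : 0 < p by rewrite lt_neqAle eq_sym p_neq0.
rewrite le_eqVlt => /predU1P[<-|x0].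
  rewrite powR0 ?gt_eqF// !sub0r mulrN1 ltrN2 invf_gt1//.
have lx : ln x != 0 by rewrite ln_eq0.
(* divide [x^p < p x + (1 - p)] by [x^p] and bound the two exponentials *)
have h1 : 1 + (1 - p) * ln x < powR x (1 - p).
  by rewrite /powR gt_eqF// expR_gt1Dx// mulf_neq0// subr_eq0 gt_eqF.
have h2 : 1 + - p * ln x < powR x (- p).
  by rewrite /powR gt_eqF// expR_gt1Dx// mulf_neq0// oppr_eq0 gt_eqF.
have xp0 := powR_gt0 p x0.
have e1 : powR x p * powR x (1 - p) = x.
  by rewrite -powRD ?(lt0r_neq0 x0) ?implybT// [p + _]addrC subrK powRr1 ?ltW.
have e2 : powR x p * powR x (- p) = 1 by rewrite powRN divff ?gt_eqF.
rewrite ltr_pdivrMl//.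
set a := powR x (1 - p) in h1 e1; set b := powR x (- p) in h2 e2.
(* With weights [p] and [1 - p] the logarithms in the two lower bounds cancel. *)
have h3 : 1 < p * a + (1 - p) * b.
  have := ltr_pM2l p_gt0 (1 + (1 - p) * ln x) a; rewrite h1 => h1'.
  have := ltr_pM2l (_ : 0 < 1 - p) (1 + - p * ln x) b; rewrite h2 subr_gt0 => /(_ p_lt1) h2'.
  nra.
have : powR x p * 1 < powR x p * (p * a + (1 - p) * b) by rewrite ltr_pM2l.
rewrite mulrDr !(mulrCA (powR x p)) e1 e2; nra.
Qed.

(** By homogeneity this is the tangent bound at [1] for [y^-1 * x], multiplied by [powR y p]. *)
Lemma npow_lt_tangent (x y : R) : 0 < y -> power_domain p x -> x != y ->
  npow p x < npow p y + powR y p / y * (x - y).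
Proof.
move=> y0 xD xy; have y1 : y^-1 * x != 1.
  by apply: contra_neq xy => e; rewrite -[x]mul1r -(mulfV (lt0r_neq0 y0)) -mulrA e mulr1.
have y'0 : 0 < y^-1 by rewrite invr_gt0.
have := npow_lt_tangent1 (power_domainM y'0 xD) y1.
have yp0 := powR_gt0 p y0; have x0 := power_domain_ge0 xD.
rewrite -(ltr_pM2l yp0) mulrBr -!npowM ?(ltW y0) ?mulr_ge0 ?(ltW y'0)//.
rewrite mulVKf ?gt_eqF// mulr1 ltrBlDl => /lt_le_trans; apply.
by rewrite lerD2l -[leRHS]mulrA [_^-1 * (_ - _)]mulrBr mulVf ?gt_eqF.
Qed.

Lemma npow_lt (x y : R) : power_domain p x -> x < y -> npow p x < npow p y.
Proof.
move=> xD xy; have y0 := le_lt_trans (power_domain_ge0 xD) xy.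
have := npow_lt_tangent y0 xD (negbT (lt_eqF xy)).
move=> /lt_trans; apply; rewrite gtrDl pmulr_rlt0 ?subr_lt0//.
by rewrite divr_gt0// powR_gt0.
Qed.

Lemma npow_le_cancel (x y : R) : power_domain p y -> npow p x <= npow p y -> x <= y.
Proof. by move=> yD; apply: contraTT; rewrite -!ltNge; exact: npow_lt. Qed.

Lemma npow_inj (x y : R) : power_domain p x -> power_domain p y ->
  npow p x = npow p y -> x = y.
Proof.
move=> xD yD e; apply/eqP; rewrite eq_le.
by apply/andP; split; apply: npow_le_cancel; rewrite ?e.
Qed.

(** For [m > 0], average the tangent bound at [m]: the linear term has mean zero. In the equality
    case every point of nonzero weight lies on the tangent, which touches the graph only at [m]. *)
Lemma npow_jensen (I : finType) (w x : I -> R) (m := \sum_i w i * x i) :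
  (forall i, 0 <= w i) -> \sum_i w i = 1 -> (forall i, power_domain p (x i)) ->
  \sum_i w i * npow p (x i) <= npow p m /\
  (\sum_i w i * npow p (x i) = npow p m -> forall i, w i != 0 -> x i = m).
Proof.
move=> w0 w1 xD; have mD : power_domain p m by apply: power_domain_sum.
have := power_domain_ge0 mD; rewrite le_eqVlt => /predU1P[m0|m0].
  (* the slope of the tangent at [0] is infinite when [0 < p] *)
  have wx i : w i != 0 -> x i = 0.
    move=> wi; have /eqP := esym m0; rewrite psumr_eq0 => [/allP h|j _]; last first.
      by rewrite mulr_ge0// power_domain_ge0.
    by have := h i (mem_index_enum i); rewrite mulf_eq0 (negbTE wi) => /eqP.
  rewrite -m0; split=> [|_ //].
  suff -> : \sum_i w i * npow p (x i) = npow p 0 by [].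
  rewrite -[RHS]mul1r -w1 mulr_suml; apply: eq_bigr => i _.
  by have [->|/wx ->//] := eqVneq (w i) 0; rewrite !mul0r.
pose g := powR m p / m; pose T y := npow p m + g * (y - m).
have eT : \sum_i w i * T (x i) = npow p m.
  have eTi i : w i * T (x i) = w i * (npow p m - g * m) + g * (w i * x i).
    by rewrite /T; ring.
  under eq_bigr do rewrite eTi.
  by rewrite big_split /= -mulr_suml w1 mul1r -mulr_sumr subrK.
have le1 i : w i * npow p (x i) <= w i * T (x i).
  rewrite ler_wpM2l//; have [->|xm] := eqVneq (x i) m; last exact/ltW/npow_lt_tangent.
  by rewrite /T subrr mulr0 addr0.
split; first by rewrite -eT; apply: ler_sum.
rewrite -eT => /eqP; rewrite eq_sym -subr_eq0 -sumrB psumr_eq0; last first.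
  by move=> i _; rewrite subr_ge0.
move=> /allP h i wi; apply/eqP; apply: contraT => xm.
have := h i (mem_index_enum i); rewrite -mulrBr mulf_eq0 (negbTE wi) subr_eq0 => /eqP e.
by have := npow_lt_tangent m0 (xD i) xm; rewrite -/(T _) e ltxx.
Qed.

End ScalarPower.

(** * Unitary diagonalizations with real eigenvalues, and diagonals in another basis *)

(** The basis is left free, since the equality case of Jensen diagonalizes a matrix in the
    eigenbasis of another one. *)
Definition unitary_diag (R : realType) (n : nat) (U : 'M[R[i]]_n) (d : 'I_n -> R)
    (A : 'M[R[i]]_n) : Prop :=
  U \is unitarymx /\ A = U^t* *m diag_mx (\row_j (d j)%:C) *m U.

(** For Hermitian [A] these diagonal entries are real, so taking the real part loses nothing. *)
Definition pinching (R : realType) (n : nat) (V A : 'M[R[i]]_n) (i : 'I_n) : R :=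
  complex.Re ((V *m A *m V^t*) i i).

Section UnitaryDiag.
Variables (R : realType) (n : nat).
Implicit Types (U V A B C : 'M[R[i]]_n) (d a b c : 'I_n -> R).

Lemma unitarymx_mulCl U : U \is unitarymx -> U^t* *m U = 1%:M.
Proof. by move=> Uu; rewrite -[X in _ *m X]trmxCK; apply/unitarymxP; rewrite trmxC_unitary. Qed.

Lemma unitary_diag_conj U d A : unitary_diag U d A ->
  U *m A *m U^t* = diag_mx (\row_j (d j)%:C).
Proof.
by move=> [Uu ->]; rewrite -!mulmxA (unitarymxP Uu) mulmx1 mulmxA (unitarymxP Uu) mul1mx.
Qed.

Lemma unitary_diagZ (k : R) U d A : unitary_diag U d A ->
  unitary_diag U (fun j => k * d j) (k%:C *: A).
Proof.
move=> [Uu ->]; split=> //.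
have -> : diag_mx (\row_j (k * d j)%:C) = k%:C *: diag_mx (\row_j (d j)%:C).
  by apply/matrixP => i j; rewrite !mxE rmorphM mulrnAr.
by rewrite -scalemxAr -scalemxAl.
Qed.

Lemma hermsym_unitary_diag A : A \is hermsymmx ->
  unitary_diag (spectralmx A) (fun j => complex.Re (spectral_diag A 0 j)) A.
Proof.
move=> hA; split; first exact: spectral_unitarymx.
have -> : \row_j (complex.Re (spectral_diag A 0 j))%:C = spectral_diag A.
  apply/rowP => j; rewrite !mxE RRe_real//.
  exact: (mxOverP (hermitian_spectral_diag_real hA)).
rewrite -invmx_unitary ?spectral_unitarymx//.
exact/orthomx_spectralP/hermitian_normalmx.
Qed.

(** The vector [x] is the [j]-th eigenvector; testing the quadratic form on it carries positivity of
    [A] over to its eigenvalues. *)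
Lemma unitary_diag_form U d A j : unitary_diag U d A ->
  let x := U^t* *m (delta_mx j 0 : 'cV_n) in
  x != 0 /\ (x^t* *m A *m x) 0 0 = (d j)%:C.
Proof.
move=> dA x; have [Uu _] := dA; split.
  apply/eqP => /(congr1 (mulmx U)); rewrite mulmxA (unitarymxP Uu) mul1mx mulmx0.
  by move=> /matrixP/(_ j 0)/eqP; rewrite !mxE !eqxx oner_eq0.
have -> : x^t* = (delta_mx 0 j : 'rV_n) *m U.
  by rewrite trmx_mul map_mxM trmxCK trmx_delta map_delta_mx.
rewrite -!mulmxA (mulmxA U) (mulmxA (U *m A)) (unitary_diag_conj dA).
by rewrite mulmxA -rowE -colE !mxE eqxx mulr1n.
Qed.

Lemma admissible_power_domain (p : R) U d A : admissible p A -> unitary_diag U d A ->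
  forall j, power_domain p (d j).
Proof.
move=> pA dA j; have [x0 e] := unitary_diag_form j dA; move: pA.
rewrite /admissible /power_domain; case: ifP => _ [_ h].
  by rewrite -ltcR -e; exact: h.
by rewrite -ler0c -e; exact: h.
Qed.

Lemma admissible_hermsym (p : R) A : admissible p A -> A \is hermsymmx.
Proof. by rewrite /admissible; case: ifP => _ []. Qed.

Lemma admissibleD (p : R) A B : admissible p A -> admissible p B -> admissible p (A + B).
Proof.
have hD : A \is hermsymmx -> B \is hermsymmx -> A + B \is hermsymmx.
  move=> /is_hermitianmxP hA /is_hermitianmxP hB; apply/is_hermitianmxP.
  by rewrite {1}hA {1}hB !expr0 !scale1r linearD map_mxD.
rewrite /admissible; case: (p < 0) => -[hA pA] [hB pB].
  split; first exact: hD hA hB.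
  move=> x.
  by move=> x0; rewrite mulmxDr mulmxDl mxE addr_gt0 ?pA ?pB.
split; first exact: hD hA hB.
move=> x.
by rewrite mulmxDr mulmxDl mxE addr_ge0.
Qed.

Lemma normc2_Re (z : R[i]) : (complex.Re (`|z| ^+ 2))%:C = `|z| ^+ 2.
Proof. by rewrite RRe_real// ger0_real// exprn_ge0. Qed.

Lemma unitary_row_weights (W : 'M[R[i]]_n) i : W \is unitarymx ->
  \sum_j complex.Re (`|W i j| ^+ 2) = 1.
Proof.
move=> /unitarymxP/matrixP/(_ i i); rewrite !mxE eqxx => e.
apply: complexI; rewrite rmorph_sum rmorph1; apply: etrans e; apply: eq_bigr => j _.
by rewrite !mxE -normCK; exact: normc2_Re.
Qed.

Lemma Re_normc2_ge0 (z : R[i]) : 0 <= complex.Re (`|z| ^+ 2).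
Proof. by rewrite -ler0c normc2_Re exprn_ge0. Qed.

Lemma pinching_unitary_diag U d A V i : unitary_diag U d A -> V \is unitarymx ->
  pinching V A i = \sum_j complex.Re (`|(V *m U^t*) i j| ^+ 2) * d j.
Proof.
move=> [_ ->] _; rewrite /pinching; set W := V *m U^t*.
have -> : V *m (U^t* *m diag_mx (\row_j (d j)%:C) *m U) *m V^t* =
          W *m diag_mx (\row_j (d j)%:C) *m W^t*.
  by rewrite /W trmx_mul map_mxM trmxCK !mulmxA.
rewrite mxE raddf_sum; apply: eq_bigr => j _.
rewrite mul_mx_diag !mxE mulrAC -normCK.
by rewrite -normc2_Re -rmorphM.
Qed.

End UnitaryDiag.

(** Serves the equality case: when the ends of a chain of inequalities agree, each link is an
    equality, and positive weights cancel. *)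
Lemma convex_squeeze (R : realFieldType) (s t x y z x' y' : R) : 0 < s -> 0 < t ->
  s * x <= s * x' -> t * y <= t * y' -> s * x' + t * y' <= z -> s * x + t * y = z ->
  x = x' /\ y = y'.
Proof.
move=> s0 t0 lx ly lz ez.
by split; [apply: (mulfI (lt0r_neq0 s0))|apply: (mulfI (lt0r_neq0 t0))]; lra.
Qed.

(** * Jensen's inequality for traces of powers *)

Section SpectralJensen.
Variables (R : realType) (n : nat) (p : R).
Hypotheses (p_lt1 : p < 1) (p_neq0 : p != 0).
Implicit Types (U V A B C : 'M[R[i]]_n) (d a b c : 'I_n -> R).

(** Row sums [1] of the matrix [w] allow Jensen for each [a i]; column sums [1] recover the sum over
    the eigenvalues of [A] after exchanging summations. *)
Lemma npow_pinching U d A V (a := pinching V A) :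
  unitary_diag U d A -> (forall j, power_domain p (d j)) -> V \is unitarymx ->
  [/\ forall i, power_domain p (a i),
      \sum_j npow p (d j) <= \sum_i npow p (a i) &
      \sum_j npow p (d j) = \sum_i npow p (a i) -> unitary_diag V a A].
Proof.
move=> dA dD Vu; have [Uu eA] := dA; set W := V *m U^t*.
have Utu : U^t* \is unitarymx by rewrite trmxC_unitary.
have Wu : W \is unitarymx := mul_unitarymx Vu Utu.
pose w i j := complex.Re (`|W i j| ^+ 2).
have w0 i j : 0 <= w i j by exact: Re_normc2_ge0.
have w1 i : \sum_j w i j = 1 by exact: unitary_row_weights.
have w1' j : \sum_i w i j = 1.
  have WTu : W^T \is unitarymx by rewrite trmx_unitary.
  rewrite -(unitary_row_weights j WTu).
  by apply: eq_bigr => i _; rewrite [W^T _ _]mxE.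
have aE i : a i = \sum_j w i j * d j by exact: pinching_unitary_diag.
have jensen i := npow_jensen p_lt1 p_neq0 (w0 i) (w1 i) dD.
have dE : \sum_j npow p (d j) = \sum_i \sum_j w i j * npow p (d j).
  by rewrite exchange_big; apply: eq_bigr => j _; rewrite -mulr_suml w1' mul1r.
split=> [i||]; first by rewrite aE power_domain_sum.
  by rewrite dE; apply: ler_sum => i _; rewrite aE; case: (jensen i).
rewrite dE => /eqP; rewrite eq_sym -subr_eq0 -sumrB psumr_eq0; last first.
  by move=> i _; rewrite subr_ge0 aE; case: (jensen i).
move=> /allP h; split=> //.
(* equality in Jensen says that [d j = a i] wherever [W i j != 0] *)
have WdE : W *m diag_mx (\row_j (d j)%:C) = diag_mx (\row_j (a j)%:C) *m W.
  apply/matrixP => i j; rewrite mul_mx_diag mul_diag_mx [LHS]mxE [RHS]mxE mulrC.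
  rewrite [(\row__ _) 0 j]mxE [(\row__ _) 0 i]mxE.
  have [->|Wij] := eqVneq (W i j) 0; first by rewrite !mulr0.
  congr (_%:C * _); rewrite aE.
  have := h i (mem_index_enum i); rewrite /= subr_eq0 eq_sym aE => /eqP.
  move=> /(proj2 (jensen i)); apply.
  apply: contraNneq Wij => /(congr1 (real_complex R)).
  by rewrite normc2_Re => /eqP; rewrite sqrf_eq0 normr_eq0.
(* Multiplying [WdE] on the right by [U] removes the eigenbasis of [A], because [W *m U = V]. *)
have VA : V *m A = diag_mx (\row_j (a j)%:C) *m V.
  by rewrite eA 2!mulmxA WdE -[LHS]mulmxA /W -mulmxA (unitarymx_mulCl Uu) mulmx1.
by rewrite -mulmxA -VA mulmxA (unitarymx_mulCl Vu) mul1mx.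
Qed.

(** In the basis [V] the diagonals of [A] and [B] combine linearly to [c], so [npow_pinching] for
    each matrix is followed by two-point Jensen at each index. Equality makes [V] diagonalize both
    matrices, with the same entries. *)
Lemma npow_spectral_concave U1 U2 V a b c A B (s t : R) :
  unitary_diag U1 a A -> unitary_diag U2 b B ->
  unitary_diag V c (s%:C *: A + t%:C *: B) ->
  (forall j, power_domain p (a j)) -> (forall j, power_domain p (b j)) ->
  0 <= s -> 0 <= t -> s + t = 1 ->
  s * (\sum_j npow p (a j)) + t * (\sum_j npow p (b j)) <= \sum_i npow p (c i) /\
  (0 < s -> 0 < t ->
   s * (\sum_j npow p (a j)) + t * (\sum_j npow p (b j)) = \sum_i npow p (c i) -> A = B).
Proof.
move=> dA dB dC aD bD s0 t0 st1; have [Vu _] := dC.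
have [a'D leA eqA] := npow_pinching dA aD Vu.
have [b'D leB eqB] := npow_pinching dB bD Vu.
set a' := pinching V A in a'D leA eqA; set b' := pinching V B in b'D leB eqB.
have cE i : c i = s * a' i + t * b' i.
  have /(congr1 (fun M : 'M[R[i]]_n => complex.Re (M i i))) := unitary_diag_conj dC.
  rewrite [in RHS]mxE [in RHS]mxE eqxx /= => <-.
  have ReZ (k : R) (z : R[i]) : complex.Re (k%:C * z) = k * complex.Re z.
    by case: z => x y /=; rewrite mul0r subr0.
  rewrite mulmxDr mulmxDl -!scalemxAr -!scalemxAl [in LHS]mxE.
  by rewrite [(_ *: (V *m A *m _) : 'M_n) i i]mxE [(_ *: (V *m B *m _) : 'M_n) i i]mxE
     raddfD /= !ReZ.
(* Two-point Jensen is the finite version indexed by [bool]. *)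
pose w (e : bool) := if e then s else t.
have jensen i : s * npow p (a' i) + t * npow p (b' i) <= npow p (c i) /\
    (s * npow p (a' i) + t * npow p (b' i) = npow p (c i) ->
     0 < s -> 0 < t -> a' i = b' i).
  have := @npow_jensen R p p_lt1 p_neq0 bool w (fun e => if e then a' i else b' i).
  rewrite !big_bool /= -cE => -[|//|[]|h1 h2]; [by case|by []|by []|].
  split=> // /h2 h s_gt0 t_gt0.
  by have := h true; have := h false; rewrite /w /= !gt_eqF// => -> // ->.
have jsum : s * (\sum_j npow p (a' j)) + t * (\sum_j npow p (b' j)) <= \sum_i npow p (c i).
  by rewrite !mulr_sumr -big_split; apply: ler_sum => i _; case: (jensen i).
have sA := ler_wpM2l s0 leA; have tB := ler_wpM2l t0 leB.
split; first exact: le_trans (lerD sA tB) jsum.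
move=> s_gt0 t_gt0 e.
have [eA eB] : \sum_j npow p (a j) = \sum_i npow p (a' i) /\
               \sum_j npow p (b j) = \sum_i npow p (b' i).
  exact: convex_squeeze s_gt0 t_gt0 sA tB jsum e.
have [_ ->] := eqA eA; have [_ ->] := eqB eB.
suff -> : \row_j (a' j)%:C = \row_j (b' j)%:C by [].
apply/rowP => i; rewrite !mxE; congr _%:C.
move: e; rewrite eA eB => /eqP; rewrite eq_sym !mulr_sumr -big_split -subr_eq0 -sumrB.
rewrite psumr_eq0 => [/allP h|j _]; last by rewrite subr_ge0; case: (jensen j).
have := h i (mem_index_enum i); rewrite /= subr_eq0 eq_sym => /eqP /(proj2 (jensen i)).
exact.
Qed.

(** Concavity applied to the trivial combination [1 A + 0 A], in both directions, spares any
    matching of the two lists of eigenvalues. *)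
Lemma npow_unitary_diag_unique U V a c A :
  unitary_diag U a A -> unitary_diag V c A -> (forall j, power_domain p (a j)) ->
  (forall j, power_domain p (c j)) -> \sum_j npow p (a j) = \sum_j npow p (c j).
Proof.
move=> dA dC aD cD; have A1 : A = 1%:C *: A + 0%:C *: A by rewrite scale1r scale0r addr0.
apply/eqP; rewrite eq_le; apply/andP; split.
  have := dC; rewrite {1}A1 => /(npow_spectral_concave dA dA)/(_ aD aD ler01 (lexx 0)).
  by rewrite mul1r mul0r !addr0; case.
have := dA; rewrite {1}A1 => /(npow_spectral_concave dC dC)/(_ cD cD ler01 (lexx 0)).
by rewrite mul1r mul0r !addr0; case.
Qed.

End SpectralJensen.

(** * Positivity, homogeneity and superadditivity of the Schatten operator *)

Section SchattenSuperadditivity.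
Variables (R : realType) (n : nat) (p : R).
Hypotheses (n_gt0 : (0 < n)%N) (p_lt1 : p < 1) (p_neq0 : p != 0).
Implicit Types (U A B : 'M[R[i]]_n) (d : 'I_n -> R).

Lemma unitary_diag_eq0 U d A : unitary_diag U d A -> (forall j, d j = 0) -> A = 0.
Proof.
move=> [_ ->] d0.
have -> : \row_j (d j)%:C = 0 :> 'rV[R[i]]_n.
  by apply/rowP => j; rewrite !mxE d0.
by rewrite linear0 mulmx0 mul0mx.
Qed.

Lemma admissible_neq0 A : p < 0 -> admissible p A -> A != 0.
Proof.
rewrite /admissible => -> [_ h]; apply/eqP => A0.
have := h (const_mx 1); rewrite A0 mulmx0 mul0mx mxE ltxx => F.
suff : false by [].
apply: F; apply/eqP => /colP/(_ (Ordinal n_gt0))/eqP.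
by rewrite !mxE oner_eq0.
Qed.

Lemma admissibleZ (k : R) A : power_domain p k -> admissible p A -> admissible p (k%:C *: A).
Proof.
have hZ : A \is hermsymmx -> k%:C *: A \is hermsymmx.
  move=> /is_hermitianmxP; rewrite expr0 scale1r => hA; apply/is_hermitianmxP.
  rewrite expr0 scale1r {1}hA; apply/matrixP => i j; rewrite !mxE rmorphM.
  by congr (_ * _); apply/esym/conj_Creal/complex_realP; exists k.
rewrite /power_domain /admissible; case: (p < 0) => k0 [hA pA].
  split; first exact: hZ hA.
  move=> x x0; rewrite -scalemxAr -scalemxAl mxE mulr_gt0 ?pA//.
  by rewrite ltcR.
split; first exact: hZ hA.
move=> x; rewrite -scalemxAr -scalemxAl mxE mulr_ge0 ?pA//.
by rewrite lecR.
Qed.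

(** Applying [npow] undoes the outer power [p^-1], so that estimates on sums over eigenvalues, in
    any eigenbasis, become estimates on [schatten]. *)
Lemma npow_schatten U d A : admissible p A -> unitary_diag U d A ->
  \sum_j npow p (d j) = n%:R * npow p (schatten p A).
Proof.
move=> pA dA; have dA' := hermsym_unitary_diag (admissible_hermsym pA).
rewrite (npow_unitary_diag_unique p_lt1 p_neq0 dA dA'); last 2 first.
- exact: admissible_power_domain pA dA.
- exact: admissible_power_domain pA dA'.
have S0 : 0 <= \sum_j powR (complex.Re (spectral_diag A 0 j)) p.
  by apply: sumr_ge0 => j _; exact: powR_ge0.
rewrite /npow schattenE -powRrM mulVf// powRr1; last by rewrite mulr_ge0 ?invr_ge0.
by rewrite -mulr_sumr mulrCA mulVKf// pnatr_eq0 -lt0n.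
Qed.

Lemma schatten_gt0 A : admissible p A -> A != 0 -> 0 < schatten p A.
Proof.
move=> pA; rewrite lt_neqAle powR_ge0 andbT; apply: contra_neq => /esym s0.
have dA := hermsym_unitary_diag (admissible_hermsym pA).
apply: (unitary_diag_eq0 dA) => j; have := npow_schatten pA dA.
(* The convention [powR 0 p = 0] holds for negative [p] too, so both signs are treated at once. *)
rewrite s0 /npow powR0// !mulr0 -mulr_sumr => /eqP.
rewrite mulf_eq0 invr_eq0 (negbTE p_neq0) psumr_eq0 => [/allP h|i _]; last exact: powR_ge0.
by have /eqP/powR_eq0_eq0 := h j (mem_index_enum j).
Qed.

Lemma schatten_power_domain A : admissible p A -> power_domain p (schatten p A).
Proof.
move=> pA; rewrite /power_domain; case: ifP => [p0|_]; last exact: powR_ge0.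
exact: schatten_gt0 pA (admissible_neq0 p0 pA).
Qed.

(** Both sides have the same [npow], which is injective on [power_domain]. *)
Lemma schattenZ (k : R) A : power_domain p k -> admissible p A ->
  schatten p (k%:C *: A) = k * schatten p A.
Proof.
move=> kD pA; have pkA := admissibleZ kD pA; have k0 := power_domain_ge0 kD.
have dA := hermsym_unitary_diag (admissible_hermsym pA).
have aD := admissible_power_domain pA dA.
have e : npow p (schatten p (k%:C *: A)) = npow p (k * schatten p A).
  have n0 : n%:R != 0 :> R by rewrite pnatr_eq0 -lt0n.
  apply: (mulfI n0); rewrite -(npow_schatten pkA (unitary_diagZ k dA)).
  rewrite npowM ?powR_ge0// mulrCA -(npow_schatten pA dA) mulr_sumr.
  by apply: eq_bigr => j _; rewrite npowM// (power_domain_ge0 (aD j)).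
have D1 := schatten_power_domain pkA.
have D2 : power_domain p (k * schatten p A).
  move: kD (schatten_power_domain pA); rewrite /power_domain.
  by case: ifP => _; [exact: mulr_gt0|exact: mulr_ge0].
exact: (npow_inj p_lt1 p_neq0 D1 D2 e).
Qed.

Lemma schatten_superadditive_neq0 A B : admissible p A -> admissible p B ->
  A != 0 -> B != 0 ->
  schatten p A + schatten p B <= schatten p (A + B) /\
  (schatten p (A + B) = schatten p A + schatten p B ->
   exists2 c : R, 0 < c & A = c%:C *: B).
Proof.
move=> pA pB A0 B0; have pC := admissibleD pA pB.
have al0 := schatten_gt0 pA A0; have be0 := schatten_gt0 pB B0.
have ga0 : 0 <= schatten p (A + B) by exact: powR_ge0.
have dA := hermsym_unitary_diag (admissible_hermsym pA).
have dB := hermsym_unitary_diag (admissible_hermsym pB).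
have dC := hermsym_unitary_diag (admissible_hermsym pC).
have aD := admissible_power_domain pA dA; have bD := admissible_power_domain pB dB.
have cD := admissible_power_domain pC dC.
have normalize (k : R) (M : 'M[R[i]]_n) U d : admissible p M -> 0 <= k -> unitary_diag U d M ->
    \sum_j npow p (k * d j) = n%:R * npow p (k * schatten p M).
  move=> pM k0 dM; rewrite npowM ?powR_ge0// mulrCA -(npow_schatten pM dM) mulr_sumr.
  apply: eq_bigr => j _; rewrite npowM//.
  exact: power_domain_ge0 (admissible_power_domain pM dM j).
(* From here [al], [be] and [ga] stand for the values of [schatten] at [A], [B] and [A + B]; only
   [normA], [normB] and [normC] tie them to the eigenvalues. *)
move: (schatten p A) (fun k U d => normalize k A U d pA) al0 => al normA al0.
move: (schatten p B) (fun k U d => normalize k B U d pB) be0 => be normB be0.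
have gaD := schatten_power_domain pC.
move: (schatten p (A + B)) (fun k U d => normalize k (A + B) U d pC) ga0 gaD => ga normC ga0 gaD.
have ab0 := addr_gt0 al0 be0.
have al'0 : 0 < al^-1 by rewrite invr_gt0.
have be'0 : 0 < be^-1 by rewrite invr_gt0.
have ab'0 : 0 < (al + be)^-1 by rewrite invr_gt0.
have s0 := mulr_gt0 ab'0 al0.
have t0 := mulr_gt0 ab'0 be0.
have st : (al + be)^-1 * al + (al + be)^-1 * be = 1 by rewrite -mulrDr mulVf ?gt_eqF.
have dC' := unitary_diagZ (al + be)^-1 dC.
have CE : (al + be)^-1%:C *: (A + B) =
    ((al + be)^-1 * al)%:C *: (al^-1%:C *: A) + ((al + be)^-1 * be)%:C *: (be^-1%:C *: B).
  by rewrite !scalerA -!rmorphM /= !mulfK ?gt_eqF// scalerDr.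
rewrite CE in dC'.
have [] := npow_spectral_concave p_lt1 p_neq0 (unitary_diagZ al^-1 dA) (unitary_diagZ be^-1 dB)
  dC' (fun j => power_domainM al'0 (aD j)) (fun j => power_domainM be'0 (bD j))
  (ltW s0) (ltW t0) st.
rewrite (normA _ _ _ (ltW al'0) dA) (normB _ _ _ (ltW be'0) dB) (normC _ _ _ (ltW ab'0) dC).
rewrite !mulVf ?gt_eqF// -mulrDl st mul1r => le1 eq1; split.
  move: le1; rewrite ler_pM2l ?ltr0n// => le1.
  rewrite -[leLHS]mulr1 -ler_pdivlMl//; apply: npow_le_cancel le1 => //.
  exact: power_domainM ab'0 gaD.
(* Equality makes the normalized matrices [A / al] and [B / be] coincide. *)
move=> gaE; exists (al / be); first by rewrite divr_gt0.
have := eq1 s0 t0; rewrite gaE mulVf ?gt_eqF// => /(_ erefl) AB.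
by rewrite rmorphM -scalerA -AB scalerA -rmorphM /= mulfV ?gt_eqF// scale1r.
Qed.

(** What remains are zero matrices, admissible only for [p > 0], where equality always holds:
    [A = 0] is the multiple with factor [0], and [B = 0] is the separate alternative. *)
Lemma schatten_superadditive A B : admissible p A -> admissible p B ->
  schatten p A + schatten p B <= schatten p (A + B) /\
  (schatten p (A + B) = schatten p A + schatten p B <-> nonneg_multiple p A B \/ B = 0).
Proof.
move=> pA pB.
have p_ge0 (M : 'M[R[i]]_n) : admissible p M -> M = 0 -> power_domain p 0.
  move=> pM M0; rewrite /power_domain; case: ifP => // p0.
  by have := admissible_neq0 p0 pM; rewrite M0 eqxx.
(* This is homogeneity with factor [0]. *)
have schatten0 (M : 'M[R[i]]_n) : admissible p M -> M = 0 -> schatten p M = 0.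
  move=> pM M0; have := schattenZ (p_ge0 _ pM M0) pM.
  by rewrite M0 scaler0 mul0r.
have multE : nonneg_multiple p A B \/ B = 0 ->
    schatten p (A + B) = schatten p A + schatten p B.
  move=> [[c [cD AE]]|B0]; last by rewrite (schatten0 _ pB B0) B0 !addr0.
  have -> : A + B = (c + 1)%:C *: B by rewrite AE rmorphD scalerDl scale1r.
  have c0 := power_domain_ge0 cD.
  rewrite {1}AE !schattenZ ?mulrDl ?mul1r//.
  by apply: gt0_power_domain; rewrite ltr_wpDl.
have [A0|A0] := eqVneq A 0.
  have AB : nonneg_multiple p A B.
    by exists 0; split; [exact: p_ge0 pA A0|rewrite A0 scale0r].
  split; first by rewrite multE//; left.
  by split=> // _; left.
have [B0|B0] := eqVneq B 0.
  by split; [rewrite multE//; right|split=> // _; right].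
have [le eqAB] := schatten_superadditive_neq0 pA pB A0 B0.
split=> //; split=> // /eqAB[c c0 AE]; left; exists c; split=> //.
exact: gt0_power_domain.
Qed.

(** A nonzero [B] has a positive eigenvalue, and its multiple by [k] is an eigenvalue of [k B],
    which fixes the sign of [k]. *)
Lemma power_domain_multiple (k : R) B : admissible p B -> admissible p (k%:C *: B) ->
  B != 0 -> power_domain p k.
Proof.
move=> pB pkB B0; have dB := hermsym_unitary_diag (admissible_hermsym pB).
have bD := admissible_power_domain pB dB.
have kD := admissible_power_domain pkB (unitary_diagZ k dB).
apply: contraNT B0 => kND; apply/eqP/(unitary_diag_eq0 dB) => j.
apply/eqP; rewrite eq_le (power_domain_ge0 (bD j)) andbT leNgt.
apply: contra kND => bj; have := kD j.
by rewrite /power_domain pmulr_lgt0// pmulr_lge0.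
Qed.

End SchattenSuperadditivity.

Theorem theorem1 (R : realType) (n : nat) (p : R) (A B : 'M[R[i]]_n)
    (n_ge1 : (1 <= n)%N) (p_lt1 : p < 1) (p_neq0 : p <> 0)
    (hA : admissible p A) (hB : admissible p B) :
  (schatten p (A + B) >= schatten p A + schatten p B /\
   (schatten p (A + B) = schatten p A + schatten p B <->
    nonneg_multiple p A B \/ B = 0)) /\
  (admissible p (A - B) ->
   schatten p (A - B) <= schatten p A - schatten p B /\
   (schatten p (A - B) = schatten p A - schatten p B <->
    nonneg_multiple p A B \/ B = 0)).
Proof.
move/eqP: p_neq0 => p_neq0; split; first exact: schatten_superadditive.
move=> hC; have := schatten_superadditive n_ge1 p_lt1 p_neq0 hC hB.
rewrite subrK => -[le1 eq1]; split; first by rewrite lerBrDr.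
(* The factor shifts by one between [A] and [A - B]. Going down to [c - 1], its sign is not
   inherited from [c] but comes from the admissibility of [A - B]. *)
have multE : nonneg_multiple p A B \/ B = 0 <-> nonneg_multiple p (A - B) B \/ B = 0.
  have [->|B0] := eqVneq B 0; first by split=> _; right.
  split=> -[[c [cD AE]]|B00]; try by right.
    have CE : A - B = (c - 1)%:C *: B by rewrite AE rmorphB scalerBl scale1r.
    left; exists (c - 1); split=> //.
    by apply: (power_domain_multiple hB _ B0); rewrite -CE.
  left; exists (c + 1); split; last first.
    by rewrite rmorphD scalerDl scale1r -AE subrK.
  by apply: gt0_power_domain; rewrite ltr_wpDl// (power_domain_ge0 cD).
rewrite multE -eq1; split=> [->|->]; first by rewrite subrK.
by rewrite addrK.
Qed.
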